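(* Let $A=(1,a_1,\ldots,a_k)$ be an orderly currency with $k\geq 1$. Then $a_j-a_i\in\mathcal{A}(a_1)$ for all $0\leq i<j\leq k$.
   Context: A currency is a finite sequence of integers $A=(a_0,a_1,\ldots,a_k)$ with $1=a_0<a_1<\cdots<a_k$. For an integer amount $c>0$, $\mathrm{opt}_A(c)$ is the minimum number of coins (values from $A$, repetitions allowed) summing to $c$, and $\mathrm{grd}_A(c)$ is the number of coins used by the greedy algorithm, which repeatedly takes the largest coin not exceeding the remaining amount. $A$ is orderly if $\mathrm{opt}_A(c)=\mathrm{grd}_A(c)$ for all integers $c>0$. For an integer $a>0$, $\mathcal{A}(a)=\bigcup_{m=1}^{\infty}\{ma-l: 0\leq l\leq m\}=\{a-1,a\}\cup\{2a-2,2a-1,2a\}\cup\cdots$. *)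

(* Defs.v *)
From mathcomp Require Import all_boot all_order all_algebra.

Set Implicit Arguments.
Unset Strict Implicit.
Unset Printing Implicit Defensive.

Record currency := Currency {
  coins :> seq nat;
  currencyP : (head 0 coins == 1) && sorted ltn coins
}.

(* The coin a_i of A; meaningful only for i < size A, where k = size A - 1. *)
Definition coin (A : currency) (i : nat) : nat := nth 0 A i.

(* A payment with n coins is an n-tuple of (not necessarily distinct) elements
   of A. *)
Definition payable (A : currency) (c n : nat) : bool :=
  [exists t : n.-tuple (seq_sub A), \sum_(x <- t) ssval x == c].

Lemma mem1_currency (A : currency) : 1 \in coins A.
Proof.
by case: A => -[|a s] //= /andP[/eqP -> _]; rewrite inE eqxx.
Qed.

Lemma payable_ex (A : currency) (c : nat) : exists n, payable A c n.
Proof.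
exists c; apply/existsP; exists [tuple of nseq c (SeqSub (mem1_currency A))].
by rewrite big_nseq /= iter_addn_0 mul1n.
Qed.

Definition opt (A : currency) (c : nat) : nat := ex_minn (payable_ex A c).

Definition largest_coin (A : currency) (c : nat) : nat :=
  \max_(a <- coins A | a <= c) a.

(* The first argument is fuel; c steps suffice for the amount c because each
   step lowers the amount by at least 1, see grdE. *)
Fixpoint grd_rec (A : currency) (fuel c : nat) : nat :=
  if fuel is fuel'.+1 then
    if c == 0 then 0 else (grd_rec A fuel' (c - largest_coin A c)).+1
  else 0.

Definition grd (A : currency) (c : nat) : nat := grd_rec A c c.

Lemma largest_coin_gt0 (A : currency) (c : nat) :
  0 < c -> 0 < largest_coin A c.
Proof.
by move=> c0; apply: (@leq_bigmax_seq _ _ _ id 1 (mem1_currency A) c0).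
Qed.

Lemma largest_coin_le (A : currency) (c : nat) : largest_coin A c <= c.
Proof. exact/bigmax_leqP_seq. Qed.

Lemma grd_rec_fuel (A : currency) (m n c : nat) :
  c <= m -> c <= n -> grd_rec A m c = grd_rec A n c.
Proof.
elim: m n c => [|m IHm] [|n] [|c] //= cm cn; congr _.+1.
have h : c.+1 - largest_coin A c.+1 <= c.
  by rewrite leq_subLR -add1n leq_add2r largest_coin_gt0.
by apply: IHm; apply: leq_trans h _.
Qed.

Lemma grdE (A : currency) (c : nat) :
  0 < c -> grd A c = (grd A (c - largest_coin A c)).+1.
Proof.
case: c => // c _; rewrite {1}/grd /=; congr _.+1; apply: grd_rec_fuel => //.
by rewrite leq_subLR -add1n leq_add2r largest_coin_gt0.
Qed.

Definition orderly (A : currency) : Prop :=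
  forall c : nat, 0 < c -> opt A c = grd A c.

(* Stated over int so that the differences m a - l are not truncated. *)
Definition calA (a d : int) : Prop :=
  exists m l : nat,
    [/\ 1 <= m, l <= m & d = (m%:Z * a - l%:Z)%R].

(* Main.v *)
(** Call a coin [c > 1] special when [grd (c - 1) <= a_1 - 2]; a difference
    outside [calA a_1] makes [a_j] special.  There is no special coin: let [c]
    be the least one and [X >= c] the least coin with no coin in [(X, X + c]].
    For a coin [x < X] the greedy algorithm writes [x + c = z + w] with [z > x]
    a coin and [w] a coin or [0]; if [w > 1], then [w] would be special
    because [z + (w - 1) = x + (c - 1)].  Hence [x + c - 1] or [x + c] is a coin.
    By descending induction from [X], consecutive coins up to [X] are at least
    [c - 1] apart, which is absurd for the coins [1 < a_1 < c]. *)
Require Import Defs.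
From mathcomp Require Import all_boot all_order all_algebra.
From mathcomp Require Import zify.

Set Implicit Arguments.
Unset Strict Implicit.

Lemma coin_ltn (A : currency) (i j : nat) :
  i < j -> j < size A -> coin A i < coin A j.
Proof.
move=> ij jA; have /andP[_ sA] := currencyP A.
by apply: (sorted_ltn_nth ltn_trans) => //; rewrite inE // (ltn_trans ij).
Qed.

Lemma coin0 (A : currency) : coin A 0 = 1.
Proof. by have /andP[/eqP] := currencyP A; rewrite -nth0. Qed.

Lemma coin_gt0 (A : currency) (x : nat) : x \in coins A -> 0 < x.
Proof.
move=> /(nthP 0)[[|i] lt_i <-]; rewrite -/(coin A _); first by rewrite coin0.
by apply: leq_ltn_trans (@coin_ltn A 0 i.+1 _ lt_i).
Qed.

Lemma coin1_mem (A : currency) : 1 < size A -> coin A 1 \in coins A.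
Proof. by move=> sA; apply: mem_nth. Qed.

Lemma coin1_gt1 (A : currency) : 1 < size A -> 1 < coin A 1.
Proof. by move=> sA; rewrite -[X in X < _](coin0 A) coin_ltn. Qed.

Lemma coin1_le (A : currency) (x : nat) :
  x \in coins A -> 1 < x -> coin A 1 <= x.
Proof.
move=> /(nthP 0)[[|[|i]] lt_i <-]; rewrite -/(coin A _) ?coin0 // => _.
by apply/ltnW/coin_ltn.
Qed.

Lemma largest_coin_mem (A : currency) (c : nat) :
  0 < c -> largest_coin A c \in coins A.
Proof.
move=> c_gt0; have /prednK := largest_coin_gt0 A c_gt0.
(* The maximum defaults to [0] on an empty range, so membership passes through the induction only
   together with the case [0], which positivity then excludes. *)
suff: (largest_coin A c == 0) || (largest_coin A c \in coins A).
  by case/predU1P=> [->|].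
rewrite /largest_coin big_seq_cond.
apply: (big_ind (fun n => (n == 0) || (n \in coins A))) => // [x y hx hy|x].
  by rewrite /maxn; case: ifP.
by case/andP=> ->; rewrite orbT.
Qed.

Lemma le_largest_coin (A : currency) (c x : nat) :
  x \in coins A -> x <= c -> x <= largest_coin A c.
Proof. by move=> xA xc; apply: (@leq_bigmax_seq _ _ _ id x xA xc). Qed.

Lemma payableD (A : currency) (c d m n : nat) :
  payable A c m -> payable A d n -> payable A (c + d) (m + n).
Proof.
move=> /existsP[t /eqP <-] /existsP[u /eqP <-].
by apply/existsP; exists [tuple of t ++ u]; rewrite /= big_cat.
Qed.

Lemma grd_eq0 (A : currency) (c : nat) : (grd A c == 0) = (c == 0).
Proof. by case: c => // c; rewrite grdE. Qed.

Lemma grd_le1 (A : currency) (c : nat) :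
  0 < c -> grd A c <= 1 -> c \in coins A.
Proof.
move=> c_gt0; rewrite grdE // ltnS leqn0 grd_eq0 subn_eq0 => le_c.
suff -> : c = largest_coin A c by apply: largest_coin_mem.
by apply/eqP; rewrite eqn_leq le_c largest_coin_le.
Qed.

Lemma grd_largest (A : currency) (z w : nat) :
  z \in coins A -> {in coins A, forall y, y <= z + w -> y <= z} ->
  grd A (z + w) = (grd A w).+1.
Proof.
move=> zA z_max; have z_gt0 := coin_gt0 zA.
rewrite grdE ?ltn_addr //; suff -> : largest_coin A (z + w) = z.
  by rewrite addKn.
apply/eqP; rewrite eqn_leq le_largest_coin ?leq_addr // andbT.
by rewrite z_max ?largest_coin_le // largest_coin_mem // ltn_addr.
Qed.

Lemma grd_coin (A : currency) (x : nat) : x \in coins A -> grd A x = 1.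
Proof.
by move=> xA; rewrite -[x in LHS]addn0 grd_largest // => y _; rewrite addn0.
Qed.

(** Below [coin A 1] the greedy algorithm can only take the coin [1]. *)
Lemma grd_small (A : currency) (n : nat) : n < coin A 1 -> grd A n = n.
Proof.
elim: n => // n IHn lt_n; rewrite -[in LHS]add1n grd_largest ?mem1_currency //.
  by rewrite IHn // ltnW.
move=> y yA le_y; rewrite leqNgt; apply/negP => /(coin1_le yA) le_ay.
by move: (leq_trans le_ay le_y); rewrite add1n leqNgt lt_n.
Qed.

Lemma orderly_payable (A : currency) (c : nat) :
  orderly A -> payable A c (grd A c).
Proof.
move=> oA; case: c => [|c]; last by rewrite -oA // /opt; case: ex_minnP.
by apply/existsP; exists [tuple]; rewrite /= big_nil.
Qed.

Lemma orderly_grd_le (A : currency) (c n : nat) :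
  orderly A -> payable A c n -> grd A c <= n.
Proof.
move=> oA; case: c => [|c] // c_n; rewrite -oA // /opt.
by case: ex_minnP => m _; apply.
Qed.

(** Two greedy payments concatenate to a payment of the sum, and the greedy count is minimal. *)
Lemma orderly_grdD (A : currency) (c d : nat) :
  orderly A -> grd A (c + d) <= grd A c + grd A d.
Proof.
move=> oA; apply: orderly_grd_le => //.
by apply: payableD; apply: orderly_payable.
Qed.

Lemma orderly_grdM (A : currency) (n c : nat) :
  orderly A -> grd A (n * c) <= n * grd A c.
Proof.
move=> oA; elim: n => // n IHn; rewrite !mulSn.
exact: leq_trans (orderly_grdD _ _ oA) (leq_add _ IHn).
Qed.

Lemma orderly_grd_pred_coin (A : currency) (c : nat) :
  1 < size A -> orderly A -> c \in coins A -> 1 < c ->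
  (coin A 1).-1 <= grd A c.-1.
Proof.
move=> sA oA cA c_gt1; rewrite leqNgt; apply/negP => special_c.
set a := coin A 1 in special_c *.
have aA : a \in coins A := coin1_mem sA.
pose special x := [&& x \in coins A, 1 < x & grd A x.-1 < a.-1].
have : exists x, special x by exists c; apply/and3P.
case/ex_minnP=> {cA c_gt1 special_c}c /and3P[cA c_gt1 special_c] c_min.
have a_gt2 : 2 < a.
  suff: grd A c.-1 != 0 by lia.
  by rewrite grd_eq0; lia.
have lt_ac : a < c.
  rewrite ltn_neqAle (coin1_le cA c_gt1) andbT.
  by apply: contraTneq special_c => <-; rewrite grd_small; lia.
pose isolated x :=
  [&& x \in coins A, c <= x & ~~ has (fun y => x < y <= x + c) (coins A)].
(* The largest coin is isolated; written as [largest_coin A s] it is known to be a coin. *)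
have : exists x, isolated x.
  pose s := \max_(y <- coins A) y.
  have le_s y : y \in coins A -> y <= s.
    by move=> yA; apply: (@leq_bigmax_seq _ _ _ id y yA isT).
  have s_gt0 : 0 < s by apply: leq_trans (le_s _ cA); lia.
  exists (largest_coin A s); apply/and3P; split.
  - exact: largest_coin_mem.
  - by apply: le_largest_coin => //; apply: le_s.
  - apply/hasPn => y yA; have := le_largest_coin yA (le_s _ yA); lia.
case/ex_minnP=> X /and3P[XA le_cX /hasPn X_isol] X_min.
have jump x : x \in coins A -> x < X ->
    exists2 z, z \in coins A & x < z <= X /\ x + c <= z.+1 <= (x + c).+1.
  move=> xA lt_xX; pose z := largest_coin A (x + c).
  have xc_gt0 : 0 < x + c by lia.
  have zA : z \in coins A by apply: largest_coin_mem.
  have le_z : z <= x + c by apply: largest_coin_le.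
  have z_max y : y \in coins A -> y <= x + c -> y <= z.
    exact: le_largest_coin.
  have lt_xz : x < z.
    (* If [x < c], the coin [c] itself lies in [(x, x + c]]; otherwise [x] is not isolated, by
       minimality of [X]. *)
    case: (ltnP x c) => [lt_xc|le_cx].
      by apply: leq_trans lt_xc (z_max _ cA _); rewrite leq_addl.
    have /hasP[y yA /andP[lt_xy le_y]] :
        has (fun y => x < y <= x + c) (coins A).
      apply: contraLR lt_xX => no_y; rewrite -leqNgt; apply: X_min.
      by apply/and3P.
    exact: leq_trans lt_xy (z_max _ yA le_y).
  (* Here [z <= x + c < X + c], and no coin lies in [(X, X + c]]. *)
  have le_zX : z <= X by have := X_isol z zA; lia.
  exists z => //; split; first by rewrite lt_xz.
  rewrite ltnS le_z andbT leqNgt; apply/negP => lt_z.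
  pose w := x + c - z.
  have xcE : x + c = z + w by rewrite /w; lia.
  have w_gt1 : 1 < w by rewrite /w; lia.
  (* Two coins pay [x + c], so after [z] the greedy algorithm uses at most one more. *)
  have wA : w \in coins A.
    apply: grd_le1; first by lia.
    have := orderly_grdD x c oA.
    rewrite xcE (grd_coin xA) (grd_coin cA) grd_largest //.
    by move=> y yA le_y; apply: z_max => //; lia.
  (* Since [z > x] gives [w < c], this contradicts the minimality of [c]. *)
  have : special w.
    apply/and3P; split=> //.
    have := orderly_grdD x c.-1 oA; rewrite (grd_coin xA).
    have -> : x + c.-1 = z + w.-1 by lia.
    rewrite grd_largest //; first by lia.
    by move=> y yA le_y; apply: z_max => //; lia.
  by move/c_min; rewrite /w; lia.
(* The bound [n] on [X - x] turns descent from [X] into induction on [n]. *)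
have spread n x y : X - x <= n -> x \in coins A -> y \in coins A ->
    x < X -> x < y -> x + c <= y.+1.
  elim: n x y => [|n IHn] x y; first by lia.
  move=> le_n xA yA lt_xX lt_xy; rewrite leqNgt; apply/negP => lt_y.
  have [z zA [/andP[lt_xz le_zX] /andP[le_z z_le]]] := jump x xA lt_xX.
  (* From [y < x + c - 1 <= z <= X]; so the induction hypothesis applies to [y]. *)
  have lt_yX : y < X by lia.
  have IHy u : u \in coins A -> y < u -> y + c <= u.+1.
    by move=> uA lt_yu; apply: IHn => //; lia.
  (* The chain [y + c <= z + 1 <= x + c + 1] forces [y <= x + 1]. *)
  have := IHy z zA; have yE : y = x.+1 by have := IHy z zA; lia.
  (* y = x + 1 is the only coin in (x, x + c), so x + a costs a > 2 coins. *)
  have := orderly_grdD x a oA; rewrite (grd_coin xA) (grd_coin aA).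
  have -> : x + a = y + a.-1 by lia.
  rewrite grd_largest ?grd_small //; try lia.
  move=> u uA le_u; rewrite leqNgt; apply/negP => /(IHy u uA); lia.
(* For the coins [1 < a] this yields [c <= a], against [lt_ac]. *)
have := spread _ _ _ (leqnn _) (mem1_currency A) aA; lia.
Qed.

Theorem theorem3p4 (A : currency) (k : nat) (size_A : size A = k.+1)
    (k_ge1 : 1 <= k) (A_orderly : orderly A) (i j : nat)
    (lt_ij : i < j) (le_jk : j <= k) :
  calA (coin A 1)%:Z ((coin A j)%:Z - (coin A i)%:Z)%R.
Proof.
have sA : 1 < size A by rewrite size_A.
have jA : j < size A by rewrite size_A.
have iA : coin A i \in coins A by apply: mem_nth; apply: ltn_trans lt_ij jA.
have lt_coin := coin_ltn lt_ij jA.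
have a_gt1 := coin1_gt1 sA; have i_gt0 := coin_gt0 iA.
have := orderly_grd_pred_coin sA A_orderly (mem_nth 0 jA).
rewrite -/(coin A j); set a := coin A 1 in a_gt1 *.
set b := coin A i in iA i_gt0 lt_coin *; set c := coin A j in lt_coin *.
have := divn_eq (c - b) a; have := @ltn_pmod (c - b) a.
set q := _ %/ a; set r := _ %% a => lt_ra cE c_pred.
have [r0|r_gt0] := posnP r.
  (* Here [q > 0] because [b < c]. *)
  exists q, 0; split=> //; last by lia.
  by case: q cE => // cE; lia.
(* The amount [c - 1] is paid by [b], [q] coins [a] and [r - 1] ones, which makes [q + r] coins. *)
have c_predE : c.-1 = b + q * a + r.-1 by lia.
have : (coin A 1).-1 <= q + r.
  apply: leq_trans (c_pred _) _; first by lia.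
  rewrite c_predE; apply: leq_trans (orderly_grdD _ _ A_orderly) _.
  rewrite (@grd_small A r.-1); last by rewrite -/a; lia.
  have := orderly_grdD b (q * a) A_orderly.
  have := orderly_grdM q a A_orderly.
  by rewrite (grd_coin iA) (grd_coin (coin1_mem sA)); lia.
(* The difference is [(q + 1) a - (a - r)], and [a - r <= q + 1] is the bound just obtained. *)
rewrite -/a => le_a; exists q.+1, (a - r); split; lia.
Qed.
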